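(* Assume $r_0\ne0$. Then $p_n\in V_{n+1}$ is well defined for $0\le n<N^*$, and $p_n\notin V_n$, so that $V_{n+1}=\operatorname{span}\{p_0,\dots,p_n\}$. If $1\le n<N^*$, then $\beta_{nk}=0$ for $0\le k\le n-1$. It follows that, recursively, for $n+1<N^*$, $$p_{n+1}=r_{n+1}+\beta_np_n,\quad\text{where }\beta_n:=\beta_{nn}=-\frac{(r_{n+1},A_zp_n)}{(A_zp_n,p_n)}.$$ Also, for $0\le n<N^*$, $(A_zp_n,p_k)=0$ for $0\le k\le n-1$, and hence $(A_zp_n,\varphi)=0$ for all $\varphi\in V_n$.
   Context: $V$ is a finite-dimensional complex inner product space of dimension $N$ with inner product $(\cdot,\cdot)$ (linear in the first argument) and norm $\|\cdot\|$; $A$ is a positive definite Hermitian operator on $V$; $z\in\mathbb C$ with $\arg z\in(-\pi,\pi)$; $A_z:=zI+A$. Given $g,w_0\in V$, let $r_0:=g-A_zw_0$, $V_0:=\{0\}$, $V_n:=\operatorname{span}\{r_0,A_zr_0,\dots,A_z^{n-1}r_0\}$ for $n\ge1$. The $n$th CG iterate is the unique $w_n\in w_0+V_n$ with $(A_zw_n,\varphi)=(g,\varphi)$ for all $\varphi\in V_n$, and $r_n:=g-A_zw_n$. If $r_0\neq0$, $N^*\le N$ denotes the integer such that $r_n\ne0$ for $0\le n<N^*$ and $r_n=0$ for $n\ge N^*$. The vectors $p_n$, $0\le n<N^*$, are defined recursively by $p_0:=r_0$ and, if $p_k\ne0$ for $0\le k\le n$, $$p_{n+1}:=r_{n+1}+\sum_{k=0}^n\beta_{nk}p_k,\qquad\beta_{nk}:=-\frac{(A_zr_{n+1},p_k)}{(A_zp_k,p_k)}.$$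 *)

(* Defs.v *)
From HB Require Import structures.
From mathcomp Require Import all_boot all_order all_algebra.
From mathcomp Require Import sesquilinear.
From mathcomp Require Import complex.
From mathcomp Require Import reals trigo.

Set Implicit Arguments.
Unset Strict Implicit.
Unset Printing Implicit Defensive.

Import Order.TTheory GRing.Theory Num.Theory.

Local Open Scope ring_scope.
Local Open Scope complex_scope.

(* 0 has no argument. *)
Definition is_arg (R : realType) (z : R[i]) (theta : R) : Prop :=
  exists2 rho : R, 0 < rho & z = (rho * cos theta) +i* (rho * sin theta).

Section ConjugateGradients.

(* A form [ip] of this type is linear in its first argument,
   conjugate-linear in the second, conjugate-symmetric and positive definite. *)
Variables (R : realType) (V : vectType R[i])
  (ip : {dot V for (@Num.conj R[i])}).

(* In R[i] the relation 0 < x entails that x is real. *)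
Definition posdef_hermitian (A : 'End(V)) : Prop :=
  (forall u v, ip (A u) v = ip u (A v)) /\
  (forall u, u != 0 -> 0 < ip (A u) u).

Definition shifted_op (z : R[i]) (A : 'End(V)) : 'End(V) := z *: \1%VF + A.

Definition krylov (B : 'End(V)) (v : V) (n : nat) : {vspace V} :=
  <<mkseq (fun k => iter k B v) n>>%VS.

(* For B = zI + A with A positive definite Hermitian and z not in (-oo, 0],
   exactly one vector w satisfies this, for every n. *)
Definition is_cg_iterate (B : 'End(V)) (g w0 : V) (n : nat) (w : V) : Prop :=
  let Vn := krylov B (g - B w0) n in
  w - w0 \in Vn /\ forall phi, phi \in Vn -> ip (B w) phi = ip g phi.

Definition residual (B : 'End(V)) (g : V) (w : nat -> V) (n : nat) : V :=
  g - B (w n).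

Definition is_terminal_index (r : nat -> V) (Nstar : nat) : Prop :=
  [/\ (Nstar <= \dim {:V})%N,
      forall n, (n < Nstar)%N -> r n != 0 &
      forall n, (Nstar <= n)%N -> r n = 0].

Section Directions.

Variables (B : 'End(V)) (r : nat -> V).

Definition cg_beta (p : nat -> V) (n k : nat) : R[i] :=
  - (ip (B (r n.+1)) (p k) / ip (B (p k)) (p k)).

(* The recursive construction of p_0, ..., p_n: [Some p] carries these vectors
   as p 0, ..., p n (later values of p are irrelevant), and [None] means that
   the construction broke down because some p_k with k < n is zero. *)
Fixpoint cg_dir_upto (n : nat) : option (nat -> V) :=
  if n is m.+1 then
    if cg_dir_upto m is Some p then
      if [forall k : 'I_m.+1, p k != 0] then
        Some (fun j => if (j <= m)%N then p j
                       else r m.+1 + \sum_(k < m.+1) cg_beta p m k *: p k)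
      else None
    else None
  else Some (fun=> r 0%N).

Definition cg_dir (n : nat) : V :=
  if cg_dir_upto n is Some p then p n else 0.

(* The second condition is needed because x / 0 = 0 in a field: it says that
   no coefficient occurring in p_0, ..., p_n has a zero denominator. *)
Definition cg_dir_well_defined (n : nat) : Prop :=
  cg_dir_upto n /\
  forall k, (k < n)%N -> ip (B (cg_dir k)) (cg_dir k) != 0.

Lemma cg_dir_uptoE n p k :
  cg_dir_upto n = Some p -> (k <= n)%N -> p k = cg_dir k.
Proof.
elim: n p k => [|n IHn] p k /=.
  by case=> <-; rewrite leqn0 => /eqP ->.
case E: (cg_dir_upto n) => [q|//]; case: ifP => // nz [<-].
rewrite leq_eqVlt ltnS => /predU1P[->|le_kn].
  by rewrite /cg_dir /= E nz.
by rewrite le_kn (IHn q).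
Qed.

Lemma cg_dir_upto_nz n k : cg_dir_upto n -> (k < n)%N -> cg_dir k != 0.
Proof.
elim: n k => [//|n IHn] k /=.
case E: (cg_dir_upto n) => [q|//]; case: ifP => // /forallP nz _ lt_kn.
by have := nz (Ordinal lt_kn); rewrite (cg_dir_uptoE E).
Qed.

Lemma cg_dir_uptoS n :
  cg_dir_upto n -> (forall k, (k <= n)%N -> cg_dir k != 0) ->
  cg_dir_upto n.+1.
Proof.
rewrite /=; case E: (cg_dir_upto n) => [q|//] _ nz.
suff -> : [forall k : 'I_n.+1, q k != 0] by [].
by apply/forallP=> k; rewrite (cg_dir_uptoE E) ?nz // -ltnS.
Qed.

Lemma cg_dir0 : cg_dir 0 = r 0%N. Proof. by []. Qed.

Lemma cg_dirS n : cg_dir_upto n.+1 ->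
  cg_dir n.+1 = r n.+1 + \sum_(k < n.+1) cg_beta cg_dir n k *: cg_dir k.
Proof.
rewrite {1}/cg_dir /=; case E: (cg_dir_upto n) => [q|//].
case: ifP => // nz _; rewrite ltnn; congr (_ + _).
apply: eq_bigr => k _; have le_kn : (k <= n)%N by rewrite -ltnS.
by rewrite /cg_beta (cg_dir_uptoE E).
Qed.

End Directions.

End ConjugateGradients.

(* Main.v *)
Require Import Defs.
From mathcomp Require Import all_boot all_order all_algebra.
From mathcomp Require Import sesquilinear complex reals trigo.

Set Implicit Arguments.
Unset Strict Implicit.
Unset Printing Implicit Defensive.

Import Order.TTheory GRing.Theory Num.Theory.

Local Open Scope ring_scope.
Local Open Scope complex_scope.

(** The argument uses only two properties of B := zI + A.  It is self-adjoint
up to a scalar multiple of the identity,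
  (B u, v) = (u, B v) + c (u, v)   with c := z - z^* ([shifted_op_adj]),
and (B u, u) <> 0 for u <> 0 ([shifted_op_definite]): otherwise z would equal
-(A u, u) / (u, u) and lie on the negative real axis, which its argument
forbids.

The residuals satisfy r_n in V_{n+1} and r_n _|_ V_n.  Since p_n - r_n is a
combination of p_0, ..., p_{n-1}, it lies in V_n; so p_n in V_n would give
r_n in V_n and hence r_n = 0.  Thus p_n is not in V_n as long as r_n <> 0
([cg_dir_notin]).  In particular p_n <> 0, so the recursion never breaks down
and its denominators (B p_n, p_n) do not vanish; and as V_{n+1} has at most one
dimension more than V_n, the p_k span the Krylov spaces ([krylov_cg_dir]).

The short recurrence comes from the first property.  For u in V_n both u and
B u are in V_{n+1}, to which r_{n+1} is orthogonal, so (B r_{n+1}, u) = 0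
([residual_Borth]).  With u := p_k and k < n this is beta_{nk} = 0.  The
conjugacy (B p_n, p_k) = 0 for k < n then follows by induction from the short
recurrence, the remaining coefficient being chosen so that
(B p_{n+1}, p_n) = 0 ([cg_dir_conj]). *)

(** * Krylov spaces *)

Section Krylov.

Variables (R : realType) (V : vectType R[i]).
Implicit Types (B : 'End(V)) (v u : V).

Lemma krylov0 B v : krylov B v 0 = 0%VS.
Proof. exact: span_nil. Qed.

Lemma krylovS B v n : krylov B v n.+1 = (krylov B v n + <[iter n B v]>)%VS.
Proof. by rewrite /krylov mkseqS -cats1 span_cat span_seq1. Qed.

Lemma krylov_sub B v m n : (m <= n)%N -> (krylov B v m <= krylov B v n)%VS.
Proof.
move=> /subnK <-; elim: (n - m)%N => [//|k IHk].
by rewrite addSn krylovS (subv_trans IHk) ?addvSl.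
Qed.

Lemma krylov_mem B v m n u :
  (m <= n)%N -> u \in krylov B v m -> u \in krylov B v n.
Proof. by move=> le_mn; apply/subvP/krylov_sub. Qed.

Lemma krylov_gen B v n : v \in krylov B v n.+1.
Proof. by apply: memv_span; apply/mapP; exists 0%N; rewrite ?mem_iota. Qed.

Lemma krylov_map B v n u : u \in krylov B v n -> B u \in krylov B v n.+1.
Proof.
move=> uV; suff : (B @: krylov B v n <= krylov B v n.+1)%VS.
  by move=> /subvP; apply; exact: memv_img.
rewrite /krylov limg_span; apply: sub_span => x /mapP[y /mapP[k]].
rewrite mem_iota => /= lt_kn -> ->; apply/mapP; exists k.+1 => //.
by rewrite mem_iota.
Qed.

Lemma dim_krylovS B v n :
  (\dim (krylov B v n.+1) <= (\dim (krylov B v n)).+1)%N.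
Proof.
rewrite krylovS (leq_trans (dimv_add_leqif _ _)) // -addn1 leq_add2l dim_vline.
exact: leq_b1.
Qed.

(** Consecutive Krylov spaces differ by at most one dimension, so that any
vector of the larger one outside the smaller one completes it. *)
Lemma krylovS_notin B v n u :
  u \in krylov B v n.+1 -> u \notin krylov B v n ->
  krylov B v n.+1 = (krylov B v n + <[u]>)%VS.
Proof.
move=> uS uN; apply/esym/eqP; rewrite eqEdim subv_add krylov_sub //=.
rewrite -memvE uS /= (leq_trans (dim_krylovS _ _ _)) //.
rewrite ltnNge; apply: contra uN => le_dim; rewrite memvE.
have /eqP -> : krylov B v n == (krylov B v n + <[u]>)%VS.
  by rewrite eqEdim addvSl.
exact: addvSr.
Qed.

End Krylov.

(** * The inner product and the operator zI + A *)

Section ShiftedOperator.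

Variables (R : realType) (V : vectType R[i])
  (ip : {dot V for (@Num.conj R[i])}).

Lemma ip_span_eq0 (u : V) (s : seq V) :
  {in s, forall x, ip u x = 0} -> {in <<s>>%VS, forall x, ip u x = 0}.
Proof.
move=> us x; rewrite -[s]in_tupleE => /coord_span ->.
rewrite linear_sumr big1 // => i _; rewrite linearZr_LR /= us ?mulr0 //.
exact: mem_nth.
Qed.

(** A number with an argument in the open interval (-pi, pi) is not in
(-oo, 0]; in [R[i]] the hypothesis [0 <= x] entails that x is real. *)
Lemma is_arg_neq_opp (z x : R[i]) (theta : R) :
  is_arg z theta -> - pi < theta < pi -> 0 <= x -> z != - x.
Proof.
case=> rho rho_gt0 -> /andP[lo hi] x_ge0; apply/eqP.
move: x x_ge0 => [a b]; rewrite lecE /= => /andP[/eqP -> a_ge0] [Re_eq Im_eq].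
have sin0 : sin theta = 0.
  apply/eqP; move/eqP: Im_eq.
  by rewrite oppr0 mulf_eq0 gt_eqF.
case: (ltgtP theta 0) => [neg|pos|th0].
- have := @sin_gt0_pi R (- theta).
  by rewrite sinN sin0 oppr0 ltxx oppr_gt0 neg ltrNl lo => /(_ isT).
- by have := @sin_gt0_pi R theta; rewrite sin0 ltxx pos hi => /(_ isT).
- move: Re_eq a_ge0; rewrite th0 cos0 mulr1 => rhoE.
  by rewrite -oppr_le0 -rhoE leNgt rho_gt0.
Qed.

Lemma shifted_op_adj (z : R[i]) (A : 'End(V)) (u v : V) :
  (forall u v, ip (A u) v = ip u (A v)) ->
  ip (shifted_op z A u) v = ip u (shifted_op z A v) + (z - z^*) * ip u v.
Proof.
move=> symA; rewrite /shifted_op !lfunE /= !lfunE /= !id_lfunE.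
rewrite linearDl linearDr linearZl_LR linearZr_LR /= symA mulrBl.
by rewrite [RHS]addrC addrA subrK.
Qed.

Lemma shifted_op_definite (z : R[i]) (theta : R) (A : 'End(V)) (u : V) :
  is_arg z theta -> - pi < theta < pi -> posdef_hermitian ip A ->
  u != 0 -> ip (shifted_op z A u) u != 0.
Proof.
move=> hz hth [_ posA] u0; have iu : 0 < ip u u by rewrite dnorm_gt0.
rewrite /shifted_op !lfunE /= !lfunE /= id_lfunE linearDl linearZl_LR.
have iun : ip u u != 0 by rewrite gt_eqF.
have /negP nz : z != - (ip (A u) u / ip u u).
  by apply: is_arg_neq_opp hz hth _; rewrite divr_ge0 ?ltW ?posA.
apply/negP; rewrite addr_eq0 => /eqP e; apply: nz.
by rewrite -mulNr -e mulfK.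
Qed.

End ShiftedOperator.

(** * Search directions built from orthogonal residuals *)

Section Directions.

Variables (R : realType) (V : vectType R[i])
  (ip : {dot V for (@Num.conj R[i])}).
Variables (B : 'End(V)) (c : R[i]) (v : V) (r : nat -> V).

Hypothesis adjB : forall u u', ip (B u) u' = ip u (B u') + c * ip u u'.
Hypothesis defB : forall u, u != 0 -> ip (B u) u != 0.
Hypothesis r_krylov : forall n, r n \in krylov B v n.+1.
Hypothesis r_orth : forall n phi, phi \in krylov B v n -> ip (r n) phi = 0.

Let p := cg_dir ip B r.
Let beta := cg_beta ip B r p.

(** Moving B to the right costs only a multiple of the inner product itself, so
orthogonality of r_{n+1} to V_{n+1} gives that of B r_{n+1} to V_n. *)
Lemma residual_Borth n u : u \in krylov B v n -> ip (B (r n.+1)) u = 0.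
Proof.
move=> un; rewrite adjB !r_orth ?mulr0 ?addr0 ?krylov_map //.
exact: krylov_mem un.
Qed.

Lemma cg_dir_upto_le n k :
  (k <= n)%N -> cg_dir_upto ip B r n -> cg_dir_upto ip B r k.
Proof.
elim: n => [|n IHn]; first by rewrite leqn0 => /eqP ->.
rewrite leq_eqVlt ltnS => /predU1P[->//|/IHn up] upS; apply: up.
by move: upS => /=; case: (cg_dir_upto ip B r n).
Qed.

Lemma cg_dir_krylov n :
  cg_dir_upto ip B r n ->
  p n - r n \in krylov B v n /\ p n \in krylov B v n.+1.
Proof.
elim/ltn_ind: n => n IHn up.
suff pr : p n - r n \in krylov B v n.
  split=> //; rewrite -(subrK (r n) (p n)) memvD ?r_krylov //.
  exact: krylov_mem pr.
case: n => [|n] in IHn up *; first by rewrite /p cg_dir0 subrr mem0v.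
rewrite /p cg_dirS // addrC addKr memv_suml // => k _.
have [_ pk] := IHn k (ltn_ord k) (cg_dir_upto_le (ltnW (ltn_ord k)) up).
exact/memvZ/(krylov_mem _ pk).
Qed.

Lemma cg_dir_notin n :
  cg_dir_upto ip B r n -> r n != 0 -> p n \notin krylov B v n.
Proof.
move=> /cg_dir_krylov[pr _]; apply: contraNN => pn.
(* r_n would then be in V_n, hence orthogonal to itself. *)
have rn : r n \in krylov B v n by rewrite -(subKr (p n) (r n)) memvB.
by rewrite -(dnorm_eq0 ip) r_orth.
Qed.

Lemma cg_dir_neq0 n : cg_dir_upto ip B r n -> r n != 0 -> p n != 0.
Proof.
by move=> up rn; apply: contraNneq (cg_dir_notin up rn) => ->; rewrite mem0v.
Qed.

Lemma cg_dir_upto_residual n :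
  (forall k, (k < n)%N -> r k != 0) -> cg_dir_upto ip B r n.
Proof.
elim: n => [//|n IHn] rn.
have up : cg_dir_upto ip B r n by apply: IHn => k /ltnW; exact: rn.
apply: cg_dir_uptoS => // k le_kn.
by apply: cg_dir_neq0; [exact: cg_dir_upto_le up | exact: rn].
Qed.

Lemma krylov_cg_dir n :
  (forall k, (k < n)%N -> r k != 0) -> krylov B v n = <<mkseq p n>>%VS.
Proof.
elim: n => [|n IHn] rn; first by rewrite krylov0 /= span_nil.
have rn' k : (k < n)%N -> r k != 0 by move/ltnW; exact: rn.
have up := cg_dir_upto_residual rn'.
rewrite mkseqS -cats1 span_cat span_seq1 -IHn //.
by apply: krylovS_notin; [case: (cg_dir_krylov up) | exact: cg_dir_notin (rn _ _)].
Qed.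

Lemma cg_beta_eq0 n k :
  cg_dir_upto ip B r k -> (k < n)%N -> beta n k = 0.
Proof.
move=> /cg_dir_krylov[_ pk] lt_kn.
by rewrite /beta /cg_beta residual_Borth ?mul0r ?oppr0 // (krylov_mem lt_kn).
Qed.

(** The correction term in moving B to p_n vanishes because p_n is in V_{n+1},
to which r_{n+1} is orthogonal. *)
Lemma cg_beta_diag n :
  cg_dir_upto ip B r n ->
  beta n n = - (ip (r n.+1) (B (p n)) / ip (B (p n)) (p n)).
Proof.
move=> /cg_dir_krylov[_ pn].
by rewrite /beta /cg_beta adjB [X in c * X]r_orth // mulr0 addr0.
Qed.

Lemma cg_dir_short_rec n :
  cg_dir_upto ip B r n.+1 -> p n.+1 = r n.+1 + beta n n *: p n.
Proof.
move=> up; rewrite /p cg_dirS // big_ord_recr /= big1 ?add0r // => k _.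
rewrite [cg_beta _ _ _ _ _ _]cg_beta_eq0 ?scale0r //=.
exact: cg_dir_upto_le (ltnW (leq_trans (ltn_ord k) (leqnSn n))) up.
Qed.

Lemma cg_dir_conj n k :
  (forall j, (j < n)%N -> r j != 0) -> (k < n)%N -> ip (B (p n)) (p k) = 0.
Proof.
elim: n k => [//|n IHn] k rn lt_kn.
have upS := cg_dir_upto_residual rn; have up := cg_dir_upto_le (leqnSn n) upS.
rewrite cg_dir_short_rec // linearD linearZ /= linearDl linearZl_LR /=.
move: lt_kn; rewrite ltnS leq_eqVlt => /predU1P[->|lt_kn].
  rewrite /beta /cg_beta mulNr divfK ?subrr //.
  by apply: defB; apply: cg_dir_neq0 => //; exact: rn.
rewrite IHn // ?mulr0 ?addr0; last by move=> j /ltnW; exact: rn.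
have [_ pk] := cg_dir_krylov (cg_dir_upto_le (ltnW lt_kn) up).
by rewrite residual_Borth // (krylov_mem lt_kn).
Qed.

End Directions.

(** * Conjugate gradients for zI + A *)

Theorem lemma4p2 (R : realType) (V : vectType R[i])
    (ip : {dot V for (@Num.conj R[i])})
    (A : 'End(V)) (hA : posdef_hermitian ip A)
    (z : R[i]) (theta : R) (hz : is_arg z theta) (htheta : - pi < theta < pi)
    (g w0 : V) (w : nat -> V)
    (hw : forall n, is_cg_iterate ip (shifted_op z A) g w0 n (w n))
    (Nstar : nat)
    (hNstar : is_terminal_index (residual (shifted_op z A) g w) Nstar)
    (hr0 : g - shifted_op z A w0 != 0) :
  let Az := shifted_op z A in
  let Vn := krylov Az (g - Az w0) in
  let r := residual Az g w in
  let p := cg_dir ip Az r in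
  let beta := cg_beta ip Az r p in
  [/\ forall n, (n < Nstar)%N ->
        [/\ cg_dir_well_defined ip Az r n,
            p n \in Vn n.+1,
            p n \notin Vn n &
            Vn n.+1 = <<mkseq p n.+1>>%VS],
      forall n k, (1 <= n)%N -> (n < Nstar)%N -> (k <= n - 1)%N ->
        beta n k = 0,
      forall n, (n.+1 < Nstar)%N ->
        p n.+1 = r n.+1 + beta n n *: p n /\
        beta n n = - (ip (r n.+1) (Az (p n)) / ip (Az (p n)) (p n)) &
      forall n, (n < Nstar)%N ->
        (forall k, (k < n)%N -> ip (Az (p n)) (p k) = 0) /\
        (forall phi, phi \in Vn n -> ip (Az (p n)) phi = 0)].
Proof.
move=> Az Vn r p beta; have [_ rN0 _] := hNstar.
have adjB u u' : ip (Az u) u' = ip u (Az u') + (z - z^*) * ip u u'.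
  by apply: shifted_op_adj; case: hA.
have defB u : u != 0 -> ip (Az u) u != 0 by exact: shifted_op_definite hz htheta hA.
have r_krylov n : r n \in Vn n.+1.
  have [wV _] := hw n.
  have -> : r n = (g - Az w0) - Az (w n - w0).
    by rewrite linearB opprB addrA subrK.
  by rewrite memvB ?krylov_gen ?krylov_map.
have r_orth n phi : phi \in Vn n -> ip (r n) phi = 0.
  by move=> phiV; have [_ wE] := hw n; rewrite /r /residual linearBl /= -wE // subrr.
have rlt n k : (n < Nstar)%N -> (k < n)%N -> r k != 0.
  by move=> lt_nN lt_kn; apply: rN0; exact: ltn_trans lt_nN.
have up n : (n < Nstar)%N -> cg_dir_upto ip Az r n.
  by move=> lt_nN; apply: (cg_dir_upto_residual r_krylov r_orth) => k; exact: rlt.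
have orth n k : (n < Nstar)%N -> (k < n)%N -> ip (Az (p n)) (p k) = 0.
  by move=> lt_nN; apply: (cg_dir_conj adjB defB r_krylov r_orth) => j; exact: rlt.
split.
- move=> n lt_nN; have [_ pn] := cg_dir_krylov r_krylov (up n lt_nN); split=> //.
  + split=> [|k lt_kn]; first exact: up.
    apply/defB/(cg_dir_neq0 r_krylov r_orth); last exact: rlt lt_kn.
    by apply: up; exact: ltn_trans lt_nN.
  + by apply: (cg_dir_notin r_krylov r_orth (up n lt_nN)); exact: rN0.
  + apply: (krylov_cg_dir r_krylov r_orth) => k; rewrite ltnS => le_kn.
    by apply: rN0; exact: leq_ltn_trans lt_nN.
- move=> n k n_gt0 lt_nN; rewrite -ltnS subn1 prednK // => lt_kn.
  by apply: (cg_beta_eq0 adjB r_krylov r_orth) => //; apply: up; exact: ltn_trans lt_nN.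
- move=> n lt_nN; split.
    exact: (cg_dir_short_rec adjB r_krylov r_orth (up _ lt_nN)).
  exact: (cg_beta_diag adjB r_krylov r_orth (up n (ltnW lt_nN))).
- move=> n lt_nN; split=> [k|phi]; first exact: orth.
  rewrite /Vn (krylov_cg_dir r_krylov r_orth); last by move=> k; exact: rlt.
  apply: ip_span_eq0 => x /mapP[k]; rewrite mem_iota => /= lt_kn ->.
  exact: orth.
Qed.
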